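(* Let $n\in\mathbb{N}$, $n\ge 3$, and let $r\in(0,R_n)$. Let $\mathcal{F}=\mathcal{F}^{n,r}\subset\mathbb{R}^2$ be the $n$-flake dust with contraction ratio $r$, let $l:=\operatorname{dist}(\mathcal{S}_1(\mathcal{F}),\mathcal{S}_2(\mathcal{F}))$, and let $g:=\sup\{\varepsilon>0 : \mathcal{F}_\varepsilon \text{ has a hole}\}$. If $r<\dfrac{l}{2g}$, then $\mathcal{F}^{n,r}$ is not Minkowski measurable.
   Context: **$n$-flake dust.** Let $n\ge 3$ and let $V_1,\dots,V_n\in\mathbb{R}^2$ be the vertices of a regular $n$-gon, labelled consecutively. For $r\in(0,1)$ let $\mathcal{S}_i(x):=rx+(1-r)V_i$, $i=1,\dots,n$, be the associated similarities of $\mathbb{R}^2$. Put $$R_n:=\frac12\Big(1+\sum_{k=1}^{\lfloor n/4\rfloor}\cos\frac{2\pi k}{n}\Big)^{-1}.$$ For $r\in(0,R_n)$, the $n$-flake dust $\mathcal{F}^{n,r}$ is the attractor of $\{\mathcal{S}_1,\dots,\mathcal{S}_n\}$, i.e. the unique nonempty compact set $\mathcal{F}\subset\mathbb{R}^2$ with $\mathcal{F}=\bigcup_{i=1}^n\mathcal{S}_i(\mathcal{F})$. **Distances, parallel sets, holes.** For nonempty $A,B\subset\mathbb{R}^2$, $\operatorname{dist}(A,B):=\inf\{\|x-y\| : x\in A,\ y\in B\}$ and $\operatorname{dist}(x,A):=\operatorname{dist}(\{x\},A)$. For a nonempty compact set $A\subset\mathbb{R}^2$ and $\varepsilon>0$,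 $A_\varepsilon:=\{x\in\mathbb{R}^2 : \operatorname{dist}(x,A)\le\varepsilon\}$. A hole of $A_\varepsilon$ is a bounded connected component of $\mathbb{R}^2\setminus A_\varepsilon$. The number $l$ is the minimal gap width between the first-generation pieces $\mathcal{S}_i(\mathcal{F})$ of $\mathcal{F}$. **Minkowski measurability.** Let $\lambda^2$ be Lebesgue measure on $\mathbb{R}^2$. For a nonempty compact set $A\subset\mathbb{R}^2$, the Minkowski dimension is $\dim_{\mathcal{M}}(A):=2-\lim_{\varepsilon\searrow0}\frac{\ln\lambda^2(A_\varepsilon)}{\ln\varepsilon}$, if this limit exists, and the Minkowski content is $\mathcal{M}(A):=\lim_{\varepsilon\searrow 0}\lambda^2(A_\varepsilon)/\varepsilon^{2-\dim_{\mathcal{M}}(A)}$, provided this limit exists in $[0,\infty]$. $A$ is called Minkowski measurable if $\mathcal{M}(A)$ exists and is both positive and finite. (For $\mathcal{F}^{n,r}$ with $r\in(0,R_n)$ the Minkowski dimension exists and equals $-\ln n/\ln r$.) *)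

(* Defs.v *)
From HB Require Import structures.
From mathcomp Require Import all_boot all_order all_algebra.
From mathcomp Require Import all_classical all_reals all_analysis.

Set Implicit Arguments.
Unset Strict Implicit.
Unset Printing Implicit Defensive.

Import Order.TTheory GRing.Theory Num.Theory.
Import numFieldNormedType.Exports.

Local Open Scope classical_set_scope.
Local Open Scope ring_scope.

(* The plane is R * R.  The library's norm on R * R is the sup norm; it is used
   below only through the topology and the bounded sets it induces.  All
   distances are taken with respect to the Euclidean norm [enorm]. *)
Section Plane.
Context {R : realType}.
Implicit Types (A B H : set (R * R)) (x : R * R) (V : nat -> R * R) (e r : R).

Definition enorm x : R := Num.sqrt (x.1 ^+ 2 + x.2 ^+ 2).

Definition dist A B : R := inf [set enorm (x - y) | x in A & y in B].

Definition parallel_set A e : set (R * R) := [set x | dist [set x] A <= e].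

Definition is_hole A e H : Prop :=
  exists2 x, (~` parallel_set A e) x &
    H = connected_component (~` parallel_set A e) x /\ bounded_set H.

(* For a flake dust this set is nonempty and bounded, so the default value of
   [sup] on other sets is irrelevant. *)
Definition hole_threshold A : R :=
  sup [set e | 0 < e /\ exists H, is_hole A e H].

(* Only the values V 1, ..., V n matter.  The bit s is the orientation in which
   the vertices are labelled. *)
Definition regular_ngon (n : nat) V : Prop :=
  exists (c : R * R) (rho theta : R) (s : bool), 0 < rho /\
    forall i, (1 <= i <= n)%N ->
      let a := theta + (-1) ^+ s * (2 * pi * i%:R / n%:R) in
      V i = c + rho *: (cos a, sin a).

Definition flake_radius (n : nat) : R :=
  2^-1 * (1 + \sum_(1 <= k < (n %/ 4).+1) cos (2 * pi * k%:R / n%:R))^-1.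

Definition flake_sim V r (i : nat) x : R * R := r *: x + (1 - r) *: V i.

Definition is_flake_dust (n : nat) V r A : Prop :=
  [/\ A !=set0, compact A &
      A = \bigcup_(i in [set i | (1 <= i <= n)%N]) flake_sim V r i @` A].

Definition area : set (R * R) -> \bar R :=
  (@lebesgue_measure R \x @lebesgue_measure R)%E.

(* [fine] loses nothing here: a parallel set of a compact set has finite area. *)
Definition log_area_ratio A e : R := ln (fine (area (parallel_set A e))) / ln e.

Definition has_minkowski_dim A : Prop := cvg (log_area_ratio A e @[e --> 0^'+]).

Definition minkowski_dim A : R := 2 - lim (log_area_ratio A e @[e --> 0^'+]).

Definition content_ratio A e : \bar R :=
  (area (parallel_set A e) / (e `^ (2 - minkowski_dim A))%:E)%E.

(* The topology on \bar R makes this existence of the limit in [0, +oo]. *)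
Definition has_minkowski_content A : Prop :=
  has_minkowski_dim A /\ cvg (content_ratio A e @[e --> 0^'+]).

Definition minkowski_content A : \bar R := lim (content_ratio A e @[e --> 0^'+]).

Definition minkowski_measurable A : Prop :=
  has_minkowski_content A /\ (0 < minkowski_content A < +oo)%E.

End Plane.

(* Main.v *)
Require Import Defs.
From HB Require Import structures.
From mathcomp Require Import all_boot all_order all_algebra finmap.
From mathcomp Require Import all_classical all_reals all_analysis.
From mathcomp Require Import measurable_realfun.
From mathcomp Require Import zify ring lra.

(* Let 2a be the least distance between two different pieces of F; it is positive
   since r is below the flake radius.  Below the scale a the parallel sets of the
   pieces are disjoint, so the area V of the parallel sets of F satisfies
   V(e) = n r^2 V(e / r) for e < a, and a positive finite Minkowski content M
   forces V(e) = M e^s, s = 2 - dim, on the whole interval (0, a / r).  Kneser's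
   inequality V(l y) - V(l x) <= l^2 (V(y) - V(x)), for x <= y and l >= 1, then
   bounds V just beyond a / r by the power law up to a second order error.
   At the scale a (1 + t) the parallel sets of two closest pieces overlap in a
   lens of area at least c t^(3/2), so V(a (1 + t)), which still follows the
   power law, is at most n r^2 V(a (1 + t) / r) - c t^(3/2).  Comparing both
   bounds gives c t^(3/2) <= K t^2 for all small t > 0, which is absurd. *)

Set Implicit Arguments.
Unset Strict Implicit.
Unset Printing Implicit Defensive.

Import Order.TTheory GRing.Theory Num.Theory.
Import numFieldNormedType.Exports.

Local Open Scope classical_set_scope.
Local Open Scope ring_scope.

(** * The Euclidean norm and parallel sets *)

Section EuclideanPlane.
Context {R : realType}.
Implicit Types (A B : set (R * R)) (x y z : R * R) (e r : R).

Lemma enorm_ge0 x : 0 <= enorm x.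
Proof. exact: sqrtr_ge0. Qed.

Lemma enorm_sqr x : enorm x ^+ 2 = x.1 ^+ 2 + x.2 ^+ 2.
Proof. by rewrite sqr_sqrtr// addr_ge0// sqr_ge0. Qed.

Lemma enorm_le x e : 0 <= e -> (enorm x <= e) = (x.1 ^+ 2 + x.2 ^+ 2 <= e ^+ 2).
Proof. by move=> e0; rewrite -enorm_sqr ler_sqr// nnegrE// enorm_ge0. Qed.

Lemma enormZ r x : enorm (r *: x) = `|r| * enorm x.
Proof.
by rewrite /enorm /= /GRing.scale/= !exprMn -mulrDr sqrtrM ?sqr_ge0// sqrtr_sqr.
Qed.

Lemma enormN x : enorm (- x) = enorm x.
Proof. by rewrite -scaleN1r enormZ normrN1 mul1r. Qed.

Lemma enormB x y : enorm (x - y) = enorm (y - x).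
Proof. by rewrite -enormN opprB. Qed.

Lemma enorm_eq0 x : enorm x = 0 -> x = 0.
Proof.
move=> x0; have := enorm_sqr x; rewrite x0 expr0n/= => /esym/eqP.
rewrite paddr_eq0 ?sqr_ge0// !sqrf_eq0 => /andP[/eqP x1 /eqP x2].
by rewrite [x]surjective_pairing x1 x2.
Qed.

Lemma cauchy_schwarz x y : x.1 * y.1 + x.2 * y.2 <= enorm x * enorm y.
Proof.
have h : (x.1 * y.1 + x.2 * y.2) ^+ 2 <= (enorm x * enorm y) ^+ 2.
  rewrite exprMn !enorm_sqr -subr_ge0.
  have -> : (x.1 ^+ 2 + x.2 ^+ 2) * (y.1 ^+ 2 + y.2 ^+ 2)
      - (x.1 * y.1 + x.2 * y.2) ^+ 2 = (x.1 * y.2 - x.2 * y.1) ^+ 2 by ring.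
  exact: sqr_ge0.
apply: le_trans (ler_norm _) _; rewrite -ler_sqr ?nnegrE//; last first.
  by rewrite mulr_ge0 ?enorm_ge0.
by rewrite real_normK ?num_real.
Qed.

Lemma enormD x y : enorm (x + y) <= enorm x + enorm y.
Proof.
have xy0 : 0 <= enorm x + enorm y by rewrite addr_ge0 ?enorm_ge0.
rewrite enorm_le// [leRHS]sqrrD !enorm_sqr /=.
have := cauchy_schwarz x y; lra.
Qed.

Lemma enorm_dist x y z : enorm (x - z) <= enorm (x - y) + enorm (y - z).
Proof. by rewrite -{1}(subrK y x) -addrA enormD. Qed.

Lemma norm1_enorm x : `|x.1| <= enorm x.
Proof.
rewrite -ler_sqr ?nnegrE ?enorm_ge0// real_normK ?num_real// enorm_sqr.
by rewrite lerDl sqr_ge0.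
Qed.

Lemma norm2_enorm x : `|x.2| <= enorm x.
Proof.
rewrite -ler_sqr ?nnegrE ?enorm_ge0// real_normK ?num_real// enorm_sqr.
by rewrite lerDr sqr_ge0.
Qed.

Lemma continuous_enorm : continuous (@enorm R).
Proof.
move=> x; rewrite /enorm.
apply: (@continuous_comp _ _ _ (fun x : R * R => x.1 ^+ 2 + x.2 ^+ 2)).
  apply: cvgD.
    apply: (@continuous_comp _ _ _ fst (fun x : R => x ^+ 2)); first exact: cvg_fst.
    exact: exprn_continuous.
  apply: (@continuous_comp _ _ _ snd (fun x : R => x ^+ 2)); first exact: cvg_snd.
  exact: exprn_continuous.
exact: sqrt_continuous.
Qed.

(** For nonempty compact [A] this is [parallel_set A e], the infimum being attained. A witness in
    [A] makes inclusions between parallel sets immediate. *)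
Definition thick A e : set (R * R) := [set x | exists2 y, A y & enorm (x - y) <= e].

Lemma continuous_enormB x : continuous (fun y => enorm (x - y)).
Proof.
move=> y; apply: (@continuous_comp _ _ _ (fun y => x - y)).
  by apply: cvgB; [exact: cvg_cst|exact: cvg_id].
exact: continuous_enorm.
Qed.

Lemma parallel_setE A e : compact A -> A !=set0 -> parallel_set A e = thick A e.
Proof.
move=> cA A0; apply/seteqP; split => x /=; rewrite /parallel_set /thick /dist /=.
  move=> de.
  have [|y yA yP] := @compact_EVT_min _ R (fun y => enorm (x - y)) A A0 cA.
    by apply: continuous_subspaceT; exact: continuous_enormB.
  exists y; first exact: set_mem.
  apply: le_trans de; apply: lb_le_inf.
    have [a Aa] := A0; exists (enorm (x - a)); exists x => //; exists a => //.
  by move=> _ [_ -> [z Az <-]]; apply: yP; exact: mem_set.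
move=> [y Ay xy]; apply: le_trans xy; apply: ge_inf.
  by exists 0 => _ [a _ [b _ <-]]; exact: enorm_ge0.
by exists x => //; exists y.
Qed.

Lemma thickS A e e' : e <= e' -> thick A e `<=` thick A e'.
Proof. by move=> ee' x [y Ay xy]; exists y => //; exact: le_trans xy ee'. Qed.

End EuclideanPlane.

(** * Planar Lebesgue measure, homotheties and discs *)

Section Area.
Context {R : realType}.
Implicit Types (A B : set (R * R)) (x y z : R * R) (e r : R).

Local Notation RR := (measurableTypeR R).

(* The product measure lives on [measurableTypeR R * measurableTypeR R]; its
   sigma-algebra is convertible to, but not syntactically, that of [R * R]. *)
Let area_m : {measure set (RR * RR) -> \bar R} :=
  (@lebesgue_measure R \x @lebesgue_measure R)%E.

Let area_semi : semi_sigma_additive (@area R).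
Proof. exact: (@measure_semi_sigma_additive _ _ _ area_m). Qed.

HB.instance Definition _ := isMeasure.Build _ _ _ (@area R)
  (measure0 area_m) (measure_ge0 area_m) area_semi.

Lemma affine_measurable (r c : R) : measurable_fun [set: RR] (fun t : RR => r * t + c : RR).
Proof. by apply: measurable_funD => //; exact: measurable_funM. Qed.

(** The scaled pushforward of Lebesgue measure agrees with it on half-open intervals, hence
    everywhere by uniqueness. *)
Lemma lebesgue_affine (r c : R) (X : set R) : 0 < r -> measurable X ->
  (r%:E * @lebesgue_measure R ((fun t => (r * t + c)%R) @^-1` X))%E = lebesgue_measure X.
Proof.
move=> r0 mX.
pose f : RR -> RR := fun t => r * t + c.
have <- : mscale (NngNum (ltW r0)) (pushforward (@lebesgue_measure R) f) X =
    (r%:E * @lebesgue_measure R (f @^-1` X))%E by [].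
  exact: affine_measurable.
move=> mf; apply/esym/lebesgue_measure_unique => //= _ [[a b]] _ <-.
rewrite /mscale /pushforward /=.
transitivity (r%:E * @lebesgue_measure R [set` `](a - c)%R / r, (b - c)%R / r]%R])%E.
  rewrite !lebesgue_measure_itv/= !lte_fin ltr_pM2r ?invr_gt0// ltrD2r.
  case: ifP => ab; last by rewrite mule0.
  rewrite -!EFinB -EFinM; congr (_%:E); field.
  exact: lt0r_neq0.
congr (_ * lebesgue_measure _)%E.
apply/seteqP; split => t /=;
  rewrite /f !in_itv /= ltr_pdivrMr // ler_pdivlMr // ltrBlDr lerBrDr (mulrC t) //.
Qed.

Definition homothety (k : R) (c x : R * R) : R * R := k *: x + c.

Lemma measurable_homothety k c : measurable_fun setT (homothety k c).
Proof.
apply/measurable_fun_pairP; split.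
  apply: (@measurable_comp _ _ _ _ _ _ setT (fun t : R => k * t + c.1)) => //.
  exact: affine_measurable.
apply: (@measurable_comp _ _ _ _ _ _ setT (fun t : R => k * t + c.2)) => //.
exact: affine_measurable.
Qed.

(** Uniqueness of the product measure reduces this to rectangles, where each side contributes one
    factor [k] by [lebesgue_affine]. *)
Lemma area_homothety k c A : 0 < k -> measurable A ->
  ((k ^+ 2)%:E * area (homothety k c @^-1` A))%E = area A.
Proof.
move=> k0 mA.
have k2 : 0 <= k ^+ 2 by rewrite sqr_ge0.
have <- : mscale (NngNum k2) (pushforward area_m (homothety k c : RR * RR -> RR * RR)%type) A =
   ((k ^+ 2)%:E * area (homothety k c @^-1` A))%E by [].
  exact: measurable_homothety.
move=> mf; apply/esym.
apply: (@product_measure_unique _ _ RR RR R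
  (@lebesgue_measure R) (@lebesgue_measure R)) => //= A1 A2 mA1 mA2.
rewrite /mscale /pushforward /=.
have mB1 : measurable ((fun t : RR => (k * t + c.1)%R : RR) @^-1` A1).
  by rewrite -[X in measurable X]setTI; exact: affine_measurable.
have mB2 : measurable ((fun t : RR => (k * t + c.2)%R : RR) @^-1` A2).
  by rewrite -[X in measurable X]setTI; exact: affine_measurable.
have := @product_measure1E _ _ RR RR R
  (@lebesgue_measure R) (@lebesgue_measure R) _ _ mB1 mB2.
move=> E; move: (congr1 (fun w : \bar R => ((k ^+ 2)%:E * w)%E) E) => {}E.
apply: (eq_trans E).
rewrite -(lebesgue_affine c.1 k0 mA1) -(lebesgue_affine c.2 k0 mA2).
by rewrite expr2 EFinM -!muleA; congr (_ * _)%E; rewrite muleCA.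
Qed.

(** Serves to assume, in the lens bound, that the segment between the two centres is closer to the
    vertical than to the horizontal. *)
Definition swap (x : R * R) : R * R := (x.2, x.1).

Lemma area_swap A : measurable A -> area (swap @^-1` A) = area A.
Proof.
move=> mA.
have mf : measurable_fun setT (swap : RR * RR -> RR * RR)%type.
  by apply/measurable_fun_pairP; split; [exact: measurable_snd|exact: measurable_fst].
have <- : pushforward area_m (swap : RR * RR -> RR * RR)%type A =
   area (swap @^-1` A) by [].
apply/esym.
apply: (@product_measure_unique _ _ RR RR R
  (@lebesgue_measure R) (@lebesgue_measure R)) => //= A1 A2 mA1 mA2.
have E := @product_measure1E _ _ RR RR R
  (@lebesgue_measure R) (@lebesgue_measure R) _ _ mA2 mA1.
rewrite muleC; refine (eq_trans _ E); rewrite /pushforward; apply: (congr1 area_m).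
by apply/seteqP; split => -[u v] /= [].
Qed.

Definition disc x e : set (R * R) := [set z | enorm (z - x) <= e].

Lemma measurable_sqdist x :
  measurable_fun setT (fun z : R * R => (z.1 - x.1) ^+ 2 + (z.2 - x.2) ^+ 2).
Proof. by apply: measurable_funD; apply: measurable_funX; apply: measurable_funD. Qed.

Lemma measurable_enorm x : measurable_fun setT (fun z : R * R => enorm (z - x)).
Proof.
apply: (@measurable_comp _ _ _ _ _ _ setT (@Num.sqrt R)) => //.
  by apply: continuous_measurable_fun; exact: sqrt_continuous.
exact: measurable_sqdist.
Qed.

Lemma measurable_disc x e : measurable (disc x e).
Proof.
rewrite [disc x e](_ : _ =
    setT `&` (fun z : R * R => enorm (z - x)) @^-1` [set` `]-oo, e]%R]).
  exact: measurable_enorm.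
by apply/seteqP; split => z /=; rewrite in_itv/= => // -[].
Qed.

Lemma area_disc_fin x e : (area (disc x e) < +oo)%E.
Proof.
pose I (c : R) : set RR := [set` `[c - e, c + e]%R].
have sub : disc x e `<=` I x.1 `*` I x.2.
  move=> z /= ze; rewrite /I /= !in_itv /= -!ler_distlC (distrC x.1) (distrC x.2).
  have h1 := norm1_enorm (z - x); have h2 := norm2_enorm (z - x).
  by split; [exact: le_trans h1 ze|exact: le_trans h2 ze].
have mI c : measurable (I c) by exact: measurable_itv.
apply: (@le_lt_trans _ _ (area (I x.1 `*` I x.2))).
  apply: le_measure => //; rewrite inE; first exact: measurable_disc.
  by apply: (@measurableX _ _ R R); exact: measurable_itv.
have E := @product_measure1E _ _ RR RR R
  (@lebesgue_measure R) (@lebesgue_measure R) _ _ (mI x.1) (mI x.2).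
have fI c : (@lebesgue_measure R (I c) < +oo)%E.
  by rewrite /I lebesgue_measure_itv/=; case: ifP => _; rewrite -?EFinD ltry.
rewrite /area [X in (X < _)%E]E; apply: lte_mul_pinfty.
- exact: measure_ge0.
- by rewrite ge0_fin_numE ?fI ?measure_ge0.
- exact: fI.
Qed.

End Area.

Lemma area_bigcup (R : realType) (N : nat) (G : nat -> set (R * R)) :
  trivIset `I_N G -> (forall k, (k < N)%N -> measurable (G k)) ->
  area (\bigcup_(k < N) G k) = (\sum_(k < N) area (G k))%E.
Proof.
by move=> tG mG; rewrite measure_fin_bigcup// -fsbig_ord.
Qed.

Lemma area_subadditive (R : realType) (N : nat) (G : nat -> set (R * R)) A :
  measurable A -> (forall k, (k < N)%N -> measurable (G k)) ->
  A `<=` \bigcup_(k < N) G k -> (area A <= \sum_(k < N) area (G k))%E.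
Proof.
move=> mA mG AG; apply: content_subadditive => //.
by rewrite -bigcup_mkord.
Qed.

(** * Kneser's inequality for finite sets, by Voronoi cells *)

Section Kneser.
Context {R : realType}.
Implicit Types (A B : set (R * R)) (x z : R * R) (e : R).

Lemma enorm_le2 x z :
  (enorm x <= enorm z) = (x.1 ^+ 2 + x.2 ^+ 2 <= z.1 ^+ 2 + z.2 ^+ 2).
Proof. by rewrite -!enorm_sqr ler_sqr ?nnegrE ?enorm_ge0. Qed.

Lemma enorm_lt2 x z :
  (enorm x < enorm z) = (x.1 ^+ 2 + x.2 ^+ 2 < z.1 ^+ 2 + z.2 ^+ 2).
Proof. by rewrite -!enorm_sqr ltr_sqr ?nnegrE ?enorm_ge0. Qed.

Variables (y : nat -> R * R) (N : nat).

Definition sites : set (R * R) := [set y k | k in `I_N].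

(* Ties go to the smallest index, which makes the cells disjoint. *)
Definition cell (k : nat) : set (R * R) := [set x | forall j, (j < N)%N ->
  enorm (x - y k) <= enorm (x - y j) /\
  ((j < k)%N -> enorm (x - y k) < enorm (x - y j))].

Definition cell_ring k a b : set (R * R) :=
  cell k `&` (disc (y k) b `\` disc (y k) a).

Lemma measurable_cell k : measurable (cell k).
Proof.
have mle (i j : nat) : measurable [set x | enorm (x - y i) <= enorm (x - y j)].
  rewrite [X in measurable X](_ : _ = setT `&`
      (fun x => enorm (x - y i) - enorm (x - y j)) @^-1` [set` `]-oo, 0]%R]).
    apply: measurable_funB => //; exact: measurable_enorm.
  by apply/seteqP; split => x /=; rewrite in_itv/= subr_le0// => -[].
rewrite [cell k](_ : _ = \bigcap_(j < N)
  ([set x | enorm (x - y k) <= enorm (x - y j)] `&`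
   (if (j < k)%N then ~` [set x | enorm (x - y j) <= enorm (x - y k)] else setT))).
  apply: bigcap_measurableType => j _; apply: measurableI => //.
  by case: ifP => _ //; exact: measurableC.
apply/seteqP; split => x /=.
  move=> h j jN; have [h1 h2] := h j jN; split => //.
  by case: ifP => jk //=; apply/negP; rewrite -ltNge h2.
move=> h j jN; have [h1 h2] := h j jN; split => // jk.
by move: h2; rewrite jk /= => /negP; rewrite -ltNge.
Qed.

Lemma measurable_cell_ring k a b : measurable (cell_ring k a b).
Proof.
by apply: measurableI; [exact: measurable_cell|apply: measurableD; exact: measurable_disc].
Qed.

Lemma thick_sites e : thick sites e = \bigcup_(k < N) disc (y k) e.
Proof.
apply/seteqP; split => [x [_ [k kN <-] h]|x [k kN h]]; first by exists k.
by exists (y k) => //; exists k.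
Qed.

Lemma measurable_thick_sites e : measurable (thick sites e).
Proof. by rewrite thick_sites; apply: bigcup_measurable => k _; exact: measurable_disc. Qed.

Lemma trivIset_cell_ring a b : trivIset `I_N (fun k => cell_ring k a b).
Proof.
move=> i j iN jN [x [[ci _] [cj _]]].
have [lij|lji|//] := ltngtP i j.
  by have [h1 _] := ci j jN; have [_ /(_ lij)] := cj i iN; rewrite ltNge h1.
by have [h1 _] := cj i iN; have [_ /(_ lji)] := ci j jN; rewrite ltNge h1.
Qed.

(** Each point lies in the cell of its nearest site, and within that cell the distance to all the
    sites is the distance to [y k]. *)
Lemma thick_sitesD a b : thick sites b `\` thick sites a =
  \bigcup_(k < N) cell_ring k a b.
Proof.
apply/seteqP; split => x.
  rewrite !thick_sites => -[[j jN xj] xa].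
  (* [P] selects the nearest sites; the least index satisfying it is the one whose cell contains
     [x]. *)
  pose P k := (k < N)%N && `[< forall j, (j < N)%N -> enorm (x - y k) <= enorm (x - y j) >].
  have exP : exists k, P k.
    have [i _ /= iP] := arg_minP (fun i : 'I_N => enorm (x - y i))
      (erefl : xpredT (Ordinal jN)).
    exists i; rewrite /P ltn_ord /=; apply/asboolP => k kN.
    exact: (iP (Ordinal kN)).
  case: (ex_minnP exP) => k /andP[kN /asboolP kP] kmin.
  exists k => //; split.
    move=> i iN; split; first exact: kP.
    move=> ik; rewrite ltNge; apply/negP => h.
    suff /kmin : P i by rewrite leqNgt ik.
    rewrite /P iN; apply/asboolP => m mN; exact: le_trans h (kP m mN).
  split; first exact: le_trans (kP j jN) xj.
  by move=> h; apply: xa; exists k.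
rewrite !thick_sites => -[k kN [xk [xb xa]]]; split; first by exists k.
move=> [j jN xj]; apply: xa; apply: le_trans xj; exact: (xk j jN).1.
Qed.

(* Voronoi cells are star-shaped about their sites. *)
Lemma cell_ring_shrink (t a b : R) k : 0 < t <= 1 ->
  cell_ring k a b `<=` homothety t (y k - t *: y k) @^-1` cell_ring k (t * a) (t * b).
Proof.
move=> /andP[t0 t1] x [xk [xb xa]]; set z := homothety t (y k - t *: y k) x.
have zk : enorm (z - y k) = t * enorm (x - y k).
  rewrite -(ger0_norm (ltW t0)) -enormZ; congr enorm.
  by rewrite /z /homothety scalerBr addrA addrAC addrK.
(* With [z = y k + t (x - y k)], the advantage of [y k] over [y j] in squared distance is scaled by
   [t] and increased by a nonnegative term, so nearest sites stay nearest. *)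
have zj j : (z - y j).1 ^+ 2 + (z - y j).2 ^+ 2 -
      ((z - y k).1 ^+ 2 + (z - y k).2 ^+ 2) =
    t * ((x - y j).1 ^+ 2 + (x - y j).2 ^+ 2 -
      ((x - y k).1 ^+ 2 + (x - y k).2 ^+ 2)) +
    (1 - t) * ((y k - y j).1 ^+ 2 + (y k - y j).2 ^+ 2).
  by rewrite /z /homothety /= /GRing.scale /=; ring.
have pos j : 0 <= (1 - t) * ((y k - y j).1 ^+ 2 + (y k - y j).2 ^+ 2).
  by rewrite mulr_ge0 ?subr_ge0// addr_ge0 ?sqr_ge0.
split; last by split; rewrite /disc /= zk ler_pM2l.
move=> j jN; have [h1 h2] := xk j jN; split.
  rewrite enorm_le2 -subr_ge0 zj; apply: addr_ge0 => //.
  by apply: mulr_ge0; [exact: ltW|rewrite subr_ge0 -enorm_le2].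
move=> /h2; rewrite enorm_lt2 => h.
rewrite enorm_lt2 -subr_gt0 zj ltr_wpDr// mulr_gt0//.
by rewrite subr_gt0.
Qed.

(** Shrinking by [l^-1] towards its site sends each ring at scales [l a], [l b] into the ring at
    scales [a], [b] and divides areas by [l ^+ 2]; summing over the disjoint rings gives the
    claim. *)
Lemma kneser_sites (l a b : R) : 1 <= l ->
  (area (thick sites (l * b) `\` thick sites (l * a)) <=
   (l ^+ 2)%:E * area (thick sites b `\` thick sites a))%E.
Proof.
move=> l1; have l0 : 0 < l by exact: lt_le_trans l1.
rewrite !thick_sitesD !area_bigcup; first last.
- by move=> k _; exact: measurable_cell_ring.
- exact: trivIset_cell_ring.
- by move=> k _; exact: measurable_cell_ring.
- exact: trivIset_cell_ring.
rewrite ge0_sume_distrr//.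
apply: lee_sum => k _.
have t01 : 0 < l^-1 <= 1 by rewrite invr_gt0 l0 invf_le1.
have lK c : l^-1 * (l * c) = c by rewrite mulrA mulVf ?mul1r// gt_eqF.
have := @cell_ring_shrink l^-1 (l * a) (l * b) k t01; rewrite !lK => sub.
have lV0 : 0 < l^-1 by rewrite invr_gt0.
have mC := measurable_cell_ring k a b.
rewrite -(area_homothety (y k - l^-1 *: y k) lV0 mC) muleA -EFinM -exprMn mulfV ?gt_eqF//.
rewrite expr1n mul1e; apply: le_measure => //; rewrite inE.
  exact: measurable_cell_ring.
rewrite -[X in measurable X]setTI; exact: measurable_homothety.
Qed.

Lemma area_thick_sites_fin e : (area (thick sites e) < +oo)%E.
Proof.
apply: (@le_lt_trans _ _ (\sum_(k < N) area (disc (y k) e))%E).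
  apply: (@area_subadditive _ N (fun k => disc (y k) e)) => [|k _|].
  - exact: measurable_thick_sites.
  - exact: measurable_disc.
  - by rewrite thick_sites.
by apply/lte_sum_pinfty => k _; exact: area_disc_fin.
Qed.

End Kneser.

(** * Parallel sets of compact sets, approximated by finite nets *)

Section CompactThick.
Context {R : realType}.
Implicit Types (A B : set (R * R)) (x z : R * R) (e : R).

Lemma finite_net A e : compact A -> 0 < e ->
  exists (y : nat -> R * R) (N : nat), sites y N `<=` A /\ A `<=` thick (sites y N) e.
Proof.
move=> cA e0.
(* [compact_cover] needs a [ptopologicalType], which [R * R] is not canonically. *)
pose T : ptopologicalType := HB.pack (R * R)%type
  (Topological.on (R * R)%type) (isPointed.Build (R * R)%type point).
have ccA : cover_compact A by rewrite -(@compact_cover T).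
have [||D' D'A cov] := ccA (R * R)%type A (fun c => [set z | enorm (z - c) < e]).
- move=> c _.
  apply: (@open_comp _ _ (fun z => enorm (z - c)) [set t | t < e]); last exact: open_lt.
  move=> z _; apply: (@continuous_comp _ _ _ (fun z => z - c)).
    by apply: cvgB; [exact: cvg_id|exact: cvg_cst].
  exact: continuous_enorm.
- move=> z Az; exists z => //=; rewrite subrr.
  have -> : enorm (0 : R * R) = 0 by rewrite /enorm/= expr0n/= addr0 sqrtr0.
  by [].
exists (nth 0 D'), (size D'); split.
  by move=> _ [k /= kN <-]; apply/set_mem; apply: D'A; rewrite mem_nth.
move=> z /cov [c /= cD zc]; exists c; last exact: ltW.
by exists (index c D') => /=; [rewrite index_mem|rewrite nth_index].
Qed.

Lemma thick_trans A B e d : A `<=` thick B d -> thick A e `<=` thick B (e + d).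
Proof.
move=> AB x [y /AB[z Bz yz] xy]; exists z => //.
by apply: le_trans (enorm_dist x y z) _; rewrite lerD.
Qed.

Lemma thick_sub A B e : A `<=` B -> thick A e `<=` thick B e.
Proof. by move=> AB x [y /AB By xy]; exists y. Qed.

Lemma thick_limit A e x : compact A ->
  (forall m : nat, thick A (e + m.+1%:R^-1) x) -> thick A e x.
Proof.
move=> cA xA.
have A0 : A !=set0 by have [y Ay _] := xA 0%N; exists y.
have [|y yA yP] := @compact_EVT_min _ R (fun y : R * R => enorm (x - y)) A A0 cA.
  by apply: continuous_subspaceT; exact: continuous_enormB.
exists y; first exact: set_mem.
apply/ler_addgt0Pr => d d0.
have [m _ mP] := near_infty_natSinv_lt (PosNum d0).
have [z Az xz] := xA m.
apply: le_trans (yP z (mem_set Az)) (le_trans xz _).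
by rewrite lerD2l ltW//; apply: (mP m) => /=.
Qed.

(** Enlarging [e] by the mesh of a finite net gives a finite union of discs; intersecting these over
    meshes [1 / (m + 1)] recovers the set, by [thick_limit], since the nets lie in [A]. *)
Lemma measurable_thick A e : compact A -> measurable (thick A e).
Proof.
move=> cA.
have net m : {yN : (nat -> R * R) * nat | sites yN.1 yN.2 `<=` A /\
    A `<=` thick (sites yN.1 yN.2) m.+1%:R^-1}.
  apply: cid; have [||y [N yN]] := @finite_net A m.+1%:R^-1 => //.
  by exists (y, N).
rewrite [thick A e](_ : _ = \bigcap_m
    thick (sites (sval (net m)).1 (sval (net m)).2) (e + m.+1%:R^-1)).
  by apply: bigcap_measurableType => m _; exact: measurable_thick_sites.
apply/seteqP; split => x.
  by move=> xA m _; have [_ +] := svalP (net m); move=> /thick_trans; exact.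
move=> h; apply: thick_limit => // m.
by apply: thick_sub (h m I); have [] := svalP (net m).
Qed.

Lemma area_thick_fin A e : compact A -> (area (thick A e) < +oo)%E.
Proof.
move=> cA; have [y [N [_ AyN]]] := finite_net cA ltr01.
apply: le_lt_trans (area_thick_sites_fin y N (e + 1)).
apply: le_measure; rewrite ?inE; [exact: measurable_thick|exact: measurable_thick_sites|].
exact: thick_trans.
Qed.

Definition vol A e : R := fine (area (thick A e)).

Lemma area_thickE A e : compact A -> area (thick A e) = (vol A e)%:E.
Proof. by move=> cA; rewrite /vol fineK// ge0_fin_numE// area_thick_fin. Qed.

Lemma vol_le A B e d : compact A -> compact B ->
  thick A e `<=` thick B d -> vol A e <= vol B d.
Proof.
move=> cA cB sub; rewrite -lee_fin -!area_thickE//.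
by apply: le_measure; rewrite ?inE//; exact: measurable_thick.
Qed.

Lemma compact_sites (y : nat -> R * R) N : compact (sites y N).
Proof.
rewrite /sites; apply: finite_compact; apply: finite_image; exact: finite_II.
Qed.

Lemma area_thickD A a b : compact A -> a <= b ->
  area (thick A b `\` thick A a) = (vol A b - vol A a)%:E.
Proof.
move=> cA ab; rewrite measureD; last exact: area_thick_fin.
- rewrite EFinB -!area_thickE//; congr (_ - area _)%E.
  by apply/setIidPr; exact: thickS.
- exact: measurable_thick.
- exact: measurable_thick.
Qed.

(* The slack [d] comes from replacing [A] by a finite [d]-net. *)
Lemma kneser A (l a b d : R) : compact A -> 1 <= l -> a <= b -> 0 < d ->
  vol A (l * b - d) - vol A (l * a) <= l ^+ 2 * (vol A b - vol A (a - d)).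
Proof.
move=> cA l1 ab d0; have [y [N [yA Ay]]] := finite_net cA d0.
set S := sites y N in yA Ay; have cS : compact S := @compact_sites y N.
have l0 : 0 <= l by exact: le_trans l1.
have K : vol S (l * b) - vol S (l * a) <= l ^+ 2 * (vol S b - vol S a).
  have := @kneser_sites _ y N l a b l1.
  by rewrite !area_thickD// ?ler_wpM2l// -EFinM lee_fin.
(* From [S] inside [A] inside [thick S d] one has [vol A (e - d) <= vol S e <= vol A e], used at
   each of the four radii. *)
apply: le_trans (le_trans _ K) _.
  apply: lerB; apply: vol_le => //; last exact: thick_sub.
  by rewrite -{2}(subrK d (l * b)); exact: thick_trans.
rewrite ler_wpM2l ?sqr_ge0//; apply: lerB; apply: vol_le => //; first exact: thick_sub.
by rewrite -{2}(subrK d a); exact: thick_trans.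
Qed.

End CompactThick.

(** * A lower bound for the area of a lens *)

Section Lens.
Context {R : realType}.
Implicit Types (A B : set (R * R)) (z m p q : R * R) (e : R).

(** A parallelogram along the line of slope [- k] through [m]. Using a shear instead of a rotation
    keeps its vertical sections intervals of length [2 w], so that its area follows by integrating
    sections. *)
Definition slanted_box m (k h w : R) : set (R * R) :=
  [set z | `|z.1 - m.1| <= h /\ `|z.2 - m.2 + k * (z.1 - m.1)| <= w].

Lemma measurable_slanted_box m k h w : measurable (slanted_box m k h w).
Proof.
rewrite [slanted_box _ _ _ _](_ : _ =
    (setT `&` (fun z : R * R => `|z.1 - m.1|) @^-1` [set` `]-oo, h]%R])
  `&` (setT `&` (fun z : R * R => `|z.2 - m.2 + k * (z.1 - m.1)|) @^-1` [set` `]-oo, w]%R])).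
  apply: measurableI.
    apply: measurableT_comp => //; first exact: measurable_funB.
  apply: measurableT_comp => //.
  apply: measurable_funD; first exact: measurable_funB.
  by apply: measurable_funM => //; exact: measurable_funB.
by apply/seteqP; split => z /=; rewrite !in_itv/= => -[h1 h2]; [|move: h1 h2 => [_ ?] [_ ?]].
Qed.

Lemma area_slanted_box m k h w : 0 <= h -> 0 <= w ->
  area (slanted_box m k h w) = ((2 * h) * (2 * w))%:E.
Proof.
move=> h0 w0; rewrite /area /product_measure1.
pose I : set R := [set` `[m.1 - h, m.1 + h]%R].
have E (x : R) : (@lebesgue_measure R \o xsection (slanted_box m k h w)) x =
    ((2 * w)%:E * (\1_I x)%:E)%E.
  rewrite indicE; have [xI|xI] := boolP (x \in I); last first.
    rewrite mule0 /= [xsection _ _](_ : _ = set0) ?measure0//.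
    apply/seteqP; split => y //=; rewrite /xsection /= inE /slanted_box /= => -[xh _].
    by move/negP: xI; apply; rewrite inE /I /= in_itv/= -ler_distlC distrC.
  rewrite mule1 /= [xsection _ _](_ : _ =
      [set` `[m.2 - k * (x - m.1) - w, m.2 - k * (x - m.1) + w]%R]).
    rewrite lebesgue_measure_itv/= lte_fin; case: ifPn => [_|].
      by rewrite -EFinD; congr (_%:E); lra.
    by rewrite -leNgt => w0'; congr (_%:E); lra.
  apply/seteqP; split => y /=; rewrite /xsection /= inE /slanted_box /= in_itv/=.
    by move=> [_]; rewrite ler_norml => /andP[h1 h2]; apply/andP; split; lra.
  move=> /andP[h1 h2]; split; last by rewrite ler_norml; apply/andP; split; lra.
  by move: xI; rewrite inE /I /= in_itv/= -ler_distlC distrC.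
have mI : measurable (I : set (measurableTypeR R)) by exact: measurable_itv.
transitivity (\int[@lebesgue_measure R]_x ((2 * w)%:E * (\1_I x)%:E))%E;
  first by apply: eq_integral => x _; exact: E.
rewrite ge0_integralZl//; last 2 first.
- by apply/measurable_EFinP; exact: measurable_indic.
- by rewrite lee_fin mulr_ge0.
rewrite integral_indic// setIT.
have IE : @lebesgue_measure R I = (2 * h)%:E.
  rewrite /I lebesgue_measure_itv/= lte_fin; case: ifPn => [_|].
    by rewrite -EFinD; congr (_%:E); lra.
  by rewrite -leNgt => h0'; congr (_%:E); lra.
apply: (eq_trans (congr1 (fun v : \bar R => ((2 * w)%:E * v)%E) IE)).
by rewrite -EFinM mulrC.
Qed.

Definition lens p q e := disc p e `&` disc q e.

Lemma measurable_lens p q e : measurable (lens p q e).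
Proof. by apply: measurableI; exact: measurable_disc. Qed.

(* The lens contains the box of half-width [h] around the bisector of [p] and [q]. *)
Lemma area_lens_slanted p q (a d : R) : 0 < a -> enorm (p - q) = 2 * a ->
  `|(p - q).1| <= `|(p - q).2| -> 0 < d ->
  ((2 * d * Num.sqrt (a * d / 2))%:E <= area (lens p q (a + d)))%E.
Proof.
(* The choice [h ^+ 2 = a d / 2] gives [a ^+ 2 + 2 h ^+ 2 <= (a + d / 2) ^+ 2]. *)
move=> a0 pq u12 d0; set h := Num.sqrt _.
have h0 : 0 <= h by exact: sqrtr_ge0.
have h2 : h ^+ 2 = a * d / 2 by rewrite sqr_sqrtr// divr_ge0// mulr_ge0// ltW.
(* The perpendicular bisector passes through [m] with slope [- k]. The assumption on the coordinates
   of [p - q] gives [k ^+ 2 <= 1], so a horizontal move by [t] along it has squared length at most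
   [2 t ^+ 2]. *)
pose m := 2^-1 *: (p + q); pose u := p - q; pose k := u.1 / u.2.
have u2sum : u.1 ^+ 2 + u.2 ^+ 2 = 4 * a ^+ 2.
  by rewrite -enorm_sqr pq exprMn; congr (_ * _); rewrite -natrX.
have le12 : u.1 ^+ 2 <= u.2 ^+ 2.
  by rewrite -(real_normK (num_real u.1)) -(real_normK (num_real u.2)) ler_sqr ?nnegrE.
have u20 : u.2 != 0.
  apply/eqP => u20; move: le12 u2sum; rewrite u20 expr0n/= => u1 us.
  have := sqr_ge0 u.1; have := exprn_gt0 2 a0; lra.
have k2 : k ^+ 2 <= 1.
  by rewrite /k expr_div_n ler_pdivrMr ?mul1r// exprn_even_gt0.
have ku : k * u.2 = u.1 by rewrite /k divfK.
have -> : 2 * d * h = (2 * h) * (2 * (d / 2)) by field.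
rewrite -(area_slanted_box m k h0); last by rewrite divr_ge0// ltW.
apply: le_measure; rewrite ?inE; [exact: measurable_slanted_box|exact: measurable_lens|].
move=> z [zh zw].
pose t := z.1 - m.1; pose s := z.2 - m.2 + k * (z.1 - m.1).
(* The signs [1] and [-1] give the centres [p] and [q]. The point [z] is split into a point of the
   bisector, within [a + d / 2] of either centre, and a vertical displacement of at most [d / 2]. *)
have key (sg : R) : sg ^+ 2 = 1 -> enorm (z - (m + (sg / 2) *: u)) <= a + d.
  move=> sg2.
  have -> : z - (m + (sg / 2) *: u) =
      (t - sg / 2 * u.1, - k * t - sg / 2 * u.2) + (0, s).
    rewrite /t /s; case: z {zh zw t s} => z1 z2 /=.
    by congr pair; rewrite /= /GRing.scale/=; ring.
  apply: le_trans (enormD _ _) _.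
  have -> : enorm ((0, s) : R * R) = `|s|.
    by rewrite /enorm /= expr0n /= add0r sqrtr_sqr.
  apply: (@le_trans _ _ ((a + d / 2) + d / 2)); last by lra.
  apply: lerD => //.
  rewrite enorm_le /=; last by lra.
  have -> : (t - sg / 2 * u.1) ^+ 2 + (- k * t - sg / 2 * u.2) ^+ 2 =
     t ^+ 2 + k ^+ 2 * t ^+ 2 + sg ^+ 2 / 4 * (u.1 ^+ 2 + u.2 ^+ 2) by rewrite -ku; field.
  rewrite sg2 u2sum.
  have t2 : t ^+ 2 <= h ^+ 2.
    by rewrite -(real_normK (num_real t)) ler_sqr ?nnegrE.
  have kt : k ^+ 2 * t ^+ 2 <= t ^+ 2 by rewrite ler_piMl// sqr_ge0.
  have := sqr_ge0 d.
  rewrite h2 in t2; nra.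
split; rewrite /disc /=.
  have -> : p = m + (1 / 2) *: u.
    by rewrite /m /u [p]surjective_pairing [q]surjective_pairing;
      congr pair; rewrite /= /GRing.scale/=; field.
  by apply: key; rewrite expr1n.
have -> : q = m + ((- 1) / 2) *: u.
  by rewrite /m /u [p]surjective_pairing [q]surjective_pairing;
      congr pair; rewrite /= /GRing.scale/=; field.
by apply: key; rewrite sqrrN expr1n.
Qed.

Lemma area_lens p q (a d : R) : 0 < a -> enorm (p - q) = 2 * a -> 0 < d ->
  ((2 * d * Num.sqrt (a * d / 2))%:E <= area (lens p q (a + d)))%E.
Proof.
move=> a0 pq d0.
have [u12|u21] := lerP `|(p - q).1| `|(p - q).2|; first exact: area_lens_slanted.
have sw z : enorm (swap z) = enorm z by rewrite /enorm /= addrC.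
rewrite -area_swap; last exact: measurable_lens.
have -> : swap @^-1` lens p q (a + d) = lens (swap p) (swap q) (a + d).
  by apply/seteqP; split => z /= [h1 h2]; split; rewrite /disc /= -sw.
apply: area_lens_slanted => //; last exact: ltW.
by rewrite -pq -sw.
Qed.

End Lens.

(** * The contradiction between scaling, Kneser's inequality and the lens *)

Section PowerLaw.
Context {R : realType}.
Implicit Types (s x : R).

Lemma cvg_powR {T : Type} {F : set_system T} {FF : Filter F} (f : T -> R) (c s : R) :
  0 < c -> f t @[t --> F] --> c -> f t `^ s @[t --> F] --> c `^ s.
Proof.
move=> c0 fc; apply: (@continuous_cvg _ _ _ _ _ f (fun x => x `^ s)) => //.
apply/differentiable_continuous; rewrite -derivable1_diffP.
by apply: derivable_powR; rewrite in_itv/= c0.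
Qed.

Lemma powRV x s : 0 < x -> x^-1 `^ s = x `^ (- s).
Proof. by move=> x0; rewrite -powR_inv1 ?ltW// -powRrM mulN1r. Qed.

(** For [s] in [[0, 2]] both factors lie between [0] and [m ^+ 2 - 1 <= 3 (m - 1)]; for other [s]
    they have opposite signs or vanish. This product is the error left when the two bounds on the
    volume are compared. *)
Lemma powR_product_le s (m : R) : 1 <= m <= 2 ->
  (m `^ s - 1) * (m `^ (2 - s) - 1) <= 9 * (m - 1) ^+ 2.
Proof.
move=> /andP[m1 m2].
have m0 : 0 <= m by lra.
have main t : 0 <= t <= 2 -> 0 <= m `^ t - 1 <= 3 * (m - 1).
  move=> /andP[t0 t2]; apply/andP; split.
    by rewrite subr_ge0 -(powRr0 m) ler_powR.
  have : m `^ t <= m ^+ 2 by rewrite -powR_mulrn// ler_powR.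
  nra.
have neg t : t <= 0 -> (m `^ t - 1) * (m `^ (2 - t) - 1) <= 0.
  move=> t0; rewrite mulr_le0_ge0//; first by rewrite subr_le0 -(powRr0 m) ler_powR.
  by rewrite subr_ge0 -[leLHS](powRr0 m) ler_powR//; lra.
have pos : 0 <= 9 * (m - 1) ^+ 2 by rewrite mulr_ge0// sqr_ge0.
have [s0|s0] := lerP s 0; first exact: le_trans (neg s s0) pos.
have [s2|s2] := lerP s 2; last first.
  have := neg (2 - s); rewrite opprB addrCA subrr addr0 mulrC => h.
  by apply: le_trans (h _) pos; lra.
have /andP[h1 h2] : 0 <= m `^ s - 1 <= 3 * (m - 1).
  by apply: main; apply/andP; split; lra.
have /andP[h3 h4] : 0 <= m `^ (2 - s) - 1 <= 3 * (m - 1).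
  by apply: main; apply/andP; split; lra.
have := ler_pM h1 h3 h2 h4; lra.
Qed.

Section Contradiction.
(** To be read with [V = vol F], [C = N r ^+ 2], [s = 2 - minkowski_dim F], and [2 a] the least
    distance between different pieces. *)
Variables (V : R -> R) (r a C M s : R).
Hypotheses (r0 : 0 < r) (r1 : r < 1) (a0 : 0 < a) (C0 : 0 < C).
Hypothesis V_small : forall e, 0 < e < a -> V e = C * V (e / r).
Hypothesis V_lens : forall d, 0 < d ->
  V (a + d) + 2 * d * Num.sqrt (a * d / 2) <= C * V ((a + d) / r).
Hypothesis V_kneser : forall l x y d, 1 <= l -> x <= y -> 0 < d ->
  V (l * y - d) - V (l * x) <= l ^+ 2 * (V y - V (x - d)).
Hypothesis V_lim : V e / e `^ s @[e --> 0^'+] --> M.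
Hypothesis M0 : 0 < M.

(** The factor by which [V e / e ^ s] changes when [e] is replaced by [r e]. *)
Let q : R := C * r `^ (- s).

(** The range extends to [a / r] because [V_small] is applied at [r t], which is below [a] as soon
    as [t < a / r]. *)
Let ratio_scale e k : 0 < e < a / r ->
  V (r ^+ k * e) / (r ^+ k * e) `^ s = q ^+ k * (V e / e `^ s).
Proof.
move=> /andP[e0 ea]; elim: k => [|k IHk]; first by rewrite !expr0 !mul1r.
have rk : 0 < r ^+ k by exact: exprn_gt0.
have rk1 : r ^+ k <= 1 by rewrite exprn_ile1// ltW.
rewrite exprS -mulrA; set t := r ^+ k * e in IHk *.
have t0 : 0 < t by exact: mulr_gt0.
have ta : t < a / r by apply: le_lt_trans ea; rewrite ler_piMl// ltW.
rewrite V_small; last by rewrite mulr_gt0//= mulrC -ltr_pdivlMr.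
have -> : r * t / r = t by rewrite mulrC mulKf// gt_eqF.
rewrite powRM ?ltW// invfM.
rewrite exprS -(mulrA q) -IHk /q powRN.
ring.
Qed.

Let powers_cvg e : 0 < e < a / r -> q ^+ k * (V e / e `^ s) @[k --> \oo] --> M.
Proof.
move=> ea; under eq_fun do rewrite -(ratio_scale _ ea).
move/cvg_at_rightP : V_lim; apply; split.
  by move=> k; rewrite mulr_gt0 ?exprn_gt0//; case/andP: ea.
rewrite -[X in _ --> X](mul0r e); apply: cvgMl.
by apply: cvg_expr; rewrite gtr0_norm.
Qed.

(** The sequence of [powers_cvg] and its shift, which is [q] times the sequence, have the same
    limit, so [q M = M] with [M > 0]. *)
Let q1 : q = 1.
Proof.
have e0 : 0 < a / r / 2 < a / r.
  have : 0 < a / r by exact: divr_gt0.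
  by move=> ?; apply/andP; split; lra.
have c1 := powers_cvg e0.
have c2 : q * (q ^+ k * (V (a / r / 2) / (a / r / 2) `^ s)) @[k --> \oo] --> q * M.
  exact: cvgMr.
have c3 : q * (q ^+ k * (V (a / r / 2) / (a / r / 2) `^ s)) @[k --> \oo] --> M.
  under eq_fun do rewrite mulrA -exprS.
  by rewrite -(@cvg_shiftS _
    (fun k => q ^+ k * (V (a / r / 2) / (a / r / 2) `^ s))) in c1.
have E := cvg_unique _ c2 c3.
by apply: (mulIf (lt0r_neq0 M0)); rewrite mul1r; apply: E => //; exact: Rhausdorff.
Qed.

Let V_power e : 0 < e < a / r -> V e = M * e `^ s.
Proof.
move=> ea; have := powers_cvg ea.
under eq_fun do rewrite q1 expr1n mul1r.
move=> c; have -> : M = V e / e `^ s.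
  by apply: (cvg_unique _ c (cvg_cst _)) => //; exact: Rhausdorff.
by rewrite divfK// gt_eqF// powR_gt0//; case/andP: ea.
Qed.

(* Kneser's inequality with [l y - d] tending to [m (a / r)] and [y], [l x] tending to
   [a / r] from below, where [V] is the power law. *)
Let V_beyond m : 1 < m ->
  V (m * (a / r)) <= M * (a / r) `^ s * (1 + m ^+ 2 - m `^ (2 - s)).
Proof.
move=> m1; set e0 := a / r; have e0_gt0 : 0 < e0 by exact: divr_gt0.
have m0 : 0 < m by lra.
(* Kneser's inequality is used with [y = u], [x = u / l] and slack [d = m e0 t]. Then
   [l y - d = m e0] exactly, [l x = u] and [x - d = w], where [u] and [w] stay below [e0]. *)
pose u (t : R) := e0 / (1 + t); pose l (t : R) := m * (1 + t) ^+ 2.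
pose w t := u t / l t - m * e0 * t.
pose G x := M * x `^ s.
have c1 : 1 + t @[t --> (0:R)^'+] --> (1 : R).
  apply: cvg_at_right_filter; rewrite -[X in _ --> X](addr0 (1:R)).
  by apply: cvgD; [exact: cvg_cst|exact: cvg_id].
have cu : u t @[t --> 0^'+] --> e0.
  rewrite -[X in _ --> X](divr1 e0); apply: cvgM; first exact: cvg_cst.
  by apply: cvgV => //; exact: oner_neq0.
have cl : l t @[t --> 0^'+] --> m.
  rewrite -[X in _ --> X](mulr1 m); apply: cvgM; first exact: cvg_cst.
  by rewrite -[X in _ --> X](mulr1 1); apply: cvgM.
have ct : t @[t --> (0:R)^'+] --> (0:R).
  by apply: cvg_at_right_filter; exact: cvg_id.
have cw : w t @[t --> 0^'+] --> e0 / m.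
  rewrite -[X in _ --> X]subr0; apply: cvgB.
    by apply: cvgM => //; apply: cvgV => //; rewrite gt_eqF.
  by rewrite -[X in _ --> X](mulr0 (m * e0)); apply: cvgM => //; exact: cvg_cst.
have em0 : 0 < e0 / m by exact: divr_gt0.
have cH : G (u t) + l t ^+ 2 * (G (u t) - G (w t)) @[t --> 0^'+] -->
    G e0 + m ^+ 2 * (G e0 - G (e0 / m)).
  have cGu : G (u t) @[t --> 0^'+] --> G e0.
    by apply: cvgM; [exact: cvg_cst|exact: cvg_powR].
  have cGw : G (w t) @[t --> 0^'+] --> G (e0 / m).
    by apply: cvgM; [exact: cvg_cst|exact: cvg_powR].
  by apply: cvgD => //; apply: cvgM; [apply: cvgM|apply: cvgB].
have -> : M * e0 `^ s * (1 + m ^+ 2 - m `^ (2 - s)) =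
    G e0 + m ^+ 2 * (G e0 - G (e0 / m)).
  rewrite /G powRM ?invr_ge0 ?(ltW e0_gt0) ?(ltW m0)//.
  rewrite powRV// powRD; last by apply/implyP => _; rewrite gt_eqF.
  by rewrite (powR_mulrn 2 (ltW m0)); ring.
apply: cvgr_to_ge cH _; near=> t.
have t0 : 0 < t by [].
have w0 : 0 < w t by near: t; exact: (cvgr_gt (e0 / m)).
have t10 : 0 < 1 + t by lra.
have ut : 0 < u t < e0.
  by rewrite /u divr_gt0//= ltr_pdivrMr// ltr_pMr//; lra.
have lt1 : 1 <= l t by rewrite /l; nra.
have ult : u t / l t <= u t.
  by rewrite ler_pdivrMr ?(lt_le_trans ltr01)// ler_peMr//; lra.
have d0 : 0 < m * e0 * t by apply: mulr_gt0 => //; exact: mulr_gt0.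
have wt : 0 < w t < e0.
  rewrite w0 /=; have /andP[_] := ut; apply: le_lt_trans; apply: le_trans ult.
  by rewrite /w gerBl ltW.
have := V_kneser lt1 ult d0.
have -> : l t * u t - m * e0 * t = m * e0.
  by rewrite /l /u; field; rewrite gt_eqF.
have -> : l t * (u t / l t) = u t.
  by rewrite mulrC divfK// gt_eqF// (lt_le_trans ltr01).
rewrite -/(w t) (V_power ut) (V_power wt).
by rewrite -/(G _) -/(G _); lra.
Unshelve. all: by end_near.
Qed.

Lemma lens_power_law_absurd : False.
Proof.
set e0 := a / r; have e0_gt0 : 0 < e0 by exact: divr_gt0.
have ae : a < e0 by rewrite /e0 ltr_pdivlMr// gtr_pMr.
(* The bound of [powR_product_le] times [M a ^ s], with [m - 1 = d / a], is [K d ^+ 2]. *)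
pose K := 9 * (M * a `^ s) / a ^+ 2.
have as0 : 0 < a `^ s by exact: powR_gt0.
have K0 : 0 < K by rewrite /K divr_gt0 ?exprn_gt0// !mulr_gt0.
(* This is [2 sqrt (a d / 2) <= K d], squared and divided by [d]. *)
have main d : 0 < d -> d <= a -> a + d < e0 -> 2 * a <= K ^+ 2 * d.
  move=> d0 da de.
  pose m := 1 + d / a.
  have dpos : 0 < d / a by exact: divr_gt0.
  have da1 : d / a <= 1 by rewrite ler_pdivrMr// mul1r.
  have m1 : 1 < m by rewrite /m; lra.
  have adE : a + d = m * a by rewrite /m; field; rewrite gt_eqF.
  have m12 : 1 <= m <= 2 by rewrite /m; apply/andP; split; lra.
  have := V_lens d0; rewrite V_power; last by rewrite de andbT addr_gt0.
  rewrite adE -[m * a / r]mulrA => L.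
  have {}L := le_trans L (ler_wpM2l (ltW C0) (V_beyond m1)).
  (* By [q = 1], the first-order terms of the two bounds cancel. *)
  have Ce : C * e0 `^ s = a `^ s.
    rewrite /e0 powRM ?ltW ?invr_gt0// powRV// mulrCA.
    by move: q1; rewrite /q => ->; rewrite mulr1.
  have m0 : 0 < m by lra.
  rewrite (powRM s (ltW m0) (ltW a0)) in L.
  have P := powR_product_le s m12.
  have dm : m - 1 = d / a by rewrite /m; lra.
  have mm : m `^ s * m `^ (2 - s) = m ^+ 2.
    rewrite -powRD; last by apply/implyP => _; rewrite gt_eqF.
    by rewrite addrC subrK powR_mulrn// ltW.
  have L2 : 2 * d * Num.sqrt (a * d / 2) <=
      M * a `^ s * ((m `^ s - 1) * (m `^ (2 - s) - 1)).
    have -> : (m `^ s - 1) * (m `^ (2 - s) - 1) =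
        1 + m ^+ 2 - m `^ (2 - s) - m `^ s.
      by rewrite -mm; ring.
    have CE X : C * (M * e0 `^ s * X) = M * a `^ s * X by rewrite -Ce; ring.
    by move: L; rewrite -/e0 CE; lra.
  have L3 : 2 * Num.sqrt (a * d / 2) <= K * d.
    rewrite -(ler_pM2l d0).
    have -> : d * (K * d) = M * a `^ s * (9 * (m - 1) ^+ 2).
      by rewrite dm /K; field; rewrite gt_eqF.
    have := ler_wpM2l (ltW (mulr_gt0 M0 as0)) P; lra.
  have L4 : (2 * Num.sqrt (a * d / 2)) ^+ 2 <= (K * d) ^+ 2.
    by rewrite ler_sqr ?nnegrE// mulr_ge0// ?sqrtr_ge0// ltW.
  rewrite (exprMn _ K) exprMn sqr_sqrtr in L4; last by rewrite divr_ge0// mulr_ge0// ltW.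
  by rewrite -(ler_pM2r d0); lra.
(* The second term keeps [a + d] below [e0]; the third forces [K ^+ 2 d < a], contradicting
   [main]. *)
pose d := Num.min a (Num.min ((e0 - a) / 2) (a / (K ^+ 2 + 1))).
have K1 : 0 < K ^+ 2 + 1 by rewrite ltr_wpDl ?sqr_ge0.
have d0 : 0 < d by rewrite !lt_min a0 !divr_gt0// subr_gt0.
have [d1 d2 d3] : [/\ d <= a, d <= (e0 - a) / 2 & d <= a / (K ^+ 2 + 1)].
  by split; rewrite /d !ge_min lexx ?orbT.
have : 2 * a <= K ^+ 2 * d by apply: main => //; lra.
by move: d3; rewrite ler_pdivlMr//; lra.
Qed.

End Contradiction.
End PowerLaw.

(** * Self-similar sets with equal ratios and separated pieces *)

Section SelfSimilar.
Context {R : realType}.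
Implicit Types (A B : set (R * R)) (c : R * R).

Lemma continuous_homothety (r : R) c : continuous (homothety r c).
Proof.
move=> x; apply: cvgD; last exact: cvg_cst.
by apply: cvgZr; exact: cvg_id.
Qed.

Lemma compact_homothety (r : R) c A : compact A -> compact (homothety r c @` A).
Proof.
move=> cA; apply: continuous_compact => //.
by apply: continuous_subspaceT; exact: continuous_homothety.
Qed.

Lemma homothetyB (r : R) c (x y : R * R) : homothety r c x - homothety r c y = r *: (x - y).
Proof. by rewrite /homothety opprD addrACA subrr addr0 -scalerBr. Qed.

Lemma vol_homothety (r e : R) c A : 0 < r -> compact A ->
  vol (homothety r c @` A) e = r ^+ 2 * vol A (e / r).
Proof.
move=> r0 cA; have cH : compact (homothety r c @` A) by exact: compact_homothety.
apply: EFin_inj; rewrite EFinM -!area_thickE//.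
rewrite -(area_homothety c r0 (measurable_thick _ cH)).
congr (_ * area _)%E; apply/seteqP; split => x /=.
  move=> [_ [y Ay <-]]; rewrite homothetyB enormZ gtr0_norm// => h.
  by exists y => //; rewrite ler_pdivlMr// mulrC.
move=> [y Ay h]; exists (homothety r c y); first by exists y.
by rewrite homothetyB enormZ gtr0_norm// mulrC -ler_pdivlMr.
Qed.

Lemma minkowski_limit A : compact A -> A !=set0 -> minkowski_measurable A ->
  exists M : R, 0 < M /\
    vol A e / e `^ (2 - minkowski_dim A) @[e --> 0^'+] --> M.
Proof.
move=> cA A0 [[_ cv] /andP[M0 Moo]].
exists (fine (minkowski_content A)); split; first by rewrite fine_gt0// M0.
have Mfin : minkowski_content A \is a fin_num by rewrite ge0_fin_numE// ltW.
have : content_ratio A e @[e --> 0^'+] --> (fine (minkowski_content A))%:E.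
  by rewrite fineK.
move=> /fine_cvg; apply: cvg_trans; apply: near_eq_cvg; near=> e.
have e0 : 0 < e by [].
rewrite /= /content_ratio parallel_setE// area_thickE// inver gt_eqF ?powR_gt0//.
Unshelve. all: by end_near.
Qed.

Section StrongSeparation.
Variables (F : set (R * R)) (N : nat) (r a : R) (v : nat -> R * R).
Hypotheses (r0 : 0 < r) (r1 : r < 1) (a0 : 0 < a) (cF : compact F) (F0 : F !=set0).
Hypothesis FE : F = \bigcup_(k < N) (homothety r (v k) @` F).
Hypothesis sep : forall i j p q, (i < N)%N -> (j < N)%N -> i != j ->
  (homothety r (v i) @` F) p -> (homothety r (v j) @` F) q -> 2 * a <= enorm (p - q).
Variables (i0 j0 : nat) (p0 q0 : R * R).
Hypotheses (i0N : (i0 < N)%N) (j0N : (j0 < N)%N) (ij0 : i0 != j0).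
Hypotheses (p0F : (homothety r (v i0) @` F) p0) (q0F : (homothety r (v j0) @` F) q0).
Hypothesis pq0 : enorm (p0 - q0) = 2 * a.

Let piece k := homothety r (v k) @` F.
Let cpiece k : compact (piece k). Proof. exact: compact_homothety. Qed.

Let thick_pieces e : thick F e = \bigcup_(k < N) thick (piece k) e.
Proof.
apply/seteqP; split => x.
  rewrite {1}FE => -[y [k kN Py] xy]; exists k => //; exists y => //.
by move=> [k kN [y Py xy]]; exists y => //; rewrite FE; exists k.
Qed.

(** A point within [e < a] of two pieces would put them closer than [2 a], so the parallel sets of
    the pieces are disjoint. *)
Lemma vol_small e : e < a -> vol F e = N%:R * r ^+ 2 * vol F (e / r).
Proof.
move=> ea; apply: EFin_inj; rewrite -area_thickE// thick_pieces area_bigcup; last 2 first.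
- move=> i j /= iN jN [x [[y Py xy] [z Pz xz]]]; apply/eqP/negPn/negP => ij.
  have := sep iN jN ij Py Pz; apply/negP; rewrite -ltNge.
  apply: le_lt_trans (enorm_dist y x z) _; rewrite enormB; lra.
- by move=> k _; exact: measurable_thick.
under eq_bigr do rewrite area_thickE// vol_homothety//.
by rewrite sumEFin sumr_const card_ord -[_ *+ N]mulr_natl mulrA.
Qed.

Lemma vol_beyond_gap d : 0 < d ->
  vol F (a + d) + 2 * d * Num.sqrt (a * d / 2) <= N%:R * r ^+ 2 * vol F ((a + d) / r).
Proof.
move=> d0; set e := a + d; set L := 2 * d * _.
(* The overlap of the parallel sets of pieces [i0] and [j0] is counted only for [i0]; it contains
   the lens around [p0] and [q0], which is the area saved. *)
pose G k := if k == j0 then thick (piece j0) e `\` thick (piece i0) e else thick (piece k) e.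
have mG k : measurable (G k).
  by rewrite /G; case: ifP => _; [apply: measurableD|]; exact: measurable_thick.
have FG : thick F e `<=` \bigcup_(k < N) G k.
  move=> x; rewrite thick_pieces => -[k kN xk].
  have [kj|kj] := eqVneq k j0; last by exists k => //; rewrite /G (negbTE kj).
  have [xi|xi] := pselect (thick (piece i0) e x).
    by exists i0 => //; rewrite /G (negbTE ij0).
  by exists j0 => //; rewrite /G eqxx; split => //; rewrite -kj.
have vG k : (area (G k) <= (r ^+ 2 * vol F (e / r) - (if k == j0 then L else 0))%:E)%E.
  rewrite -(vol_homothety _ (v k))// /G; case: eqP => [->|_]; last first.
    by rewrite subr0 area_thickE.
  rewrite measureD; [|exact: measurable_thick|exact: measurable_thick|exact: area_thick_fin].
  rewrite EFinB -(area_thickE _ (@cpiece j0)); apply: leeB => //.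
  apply: le_trans (area_lens a0 pq0 d0) _.
  apply: le_measure; rewrite ?inE; first exact: measurable_lens.
    by apply: measurableI; exact: measurable_thick.
  by move=> x [xp xq]; split; [exists q0|exists p0].
rewrite -lerBrDr -lee_fin -area_thickE//.
apply: le_trans (area_subadditive (measurable_thick _ cF) (fun k _ => mG k) FG) _.
apply: (@le_trans _ _ (\sum_(k < N) (r ^+ 2 * vol F (e / r) -
    (if k == j0 :> nat then L else 0))%:E)%E).
  by apply: lee_sum => k _; exact: vG.
rewrite sumEFin sumrB sumr_const card_ord -[_ *+ N]mulr_natl mulrA -big_mkcond/=.
by rewrite (big_pred1 (Ordinal j0N)).
Qed.

Theorem strong_separation_not_minkowski_measurable : ~ minkowski_measurable F.
Proof.
move=> /(minkowski_limit cF F0)[M [M0 limM]].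
apply: (@lens_power_law_absurd _ (vol F) r a (N%:R * r ^+ 2) M (2 - minkowski_dim F)) => //.
- by rewrite mulr_gt0 ?exprn_gt0// ltr0n (leq_ltn_trans _ i0N).
- by move=> e /andP[_ ea]; exact: vol_small.
- exact: vol_beyond_gap.
- by move=> l x y d l1 xy d0; exact: kneser.
Qed.

End StrongSeparation.
End SelfSimilar.

(** * Trigonometry of the flake radius *)

Section Angles.
Context {R : realType}.
Variable n : nat.
Hypothesis n3 : (3 <= n)%N.
Let x : R := pi / n%:R.

Let n0 : 0 < n%:R :> R. Proof. by rewrite ltr0n; lia. Qed.

Let nx : n%:R * x = pi. Proof. by rewrite /x mulrC divfK// gt_eqF. Qed.

Let x0 : 0 < x. Proof. by rewrite divr_gt0// pi_gt0. Qed.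

(** In units of [x / 2] the right angle is [n], so comparing sines of multiples of [x] becomes
    integer arithmetic. *)
Let cos_le (u v : nat) : (u <= v <= n)%N -> cos (v%:R * (x / 2)) <= cos (u%:R * (x / 2)).
Proof.
move=> /andP[uv vn].
have uvR : u%:R <= v%:R :> R by rewrite ler_nat.
have vnR : v%:R <= n%:R :> R by rewrite ler_nat.
have u0 : 0 <= u%:R :> R by [].
have x20 : 0 < x / 2 by rewrite divr_gt0.
have b (w : R) : 0 <= w -> w <= n%:R -> w * (x / 2) \in `[0, pi].
  move=> w0 wn; rewrite in_itv/= (mulr_ge0 w0 (ltW x20))/=.
  rewrite -nx; have := ler_wpM2r (ltW x20) wn; have := mulr_gt0 n0 x0; lra.
have bu := b _ u0 (le_trans uvR vnR); have bv := b _ (le_trans u0 uvR) vnR.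
by rewrite leNgt ltr_cos// -leNgt ler_pM2r.
Qed.

(* [|2p - n| x / 2] is the distance from [p x] to the right angle. *)
Let sin_cos (p : nat) : sin (p%:R * x) = cos ((2 * p - n + (n - 2 * p))%N%:R * (x / 2)).
Proof.
rewrite -cosBpihalf -nx; have [pn|pn] := leqP (2 * p) n.
  rewrite -cosN; congr cos.
  have -> : (2 * p - n + (n - 2 * p))%N = (n - 2 * p)%N by lia.
  by rewrite natrB// natrM; field.
congr cos.
have -> : (2 * p - n + (n - 2 * p))%N = (2 * p - n)%N by lia.
by rewrite (natrB _ (ltnW pn)) natrM; field.
Qed.

Let sin_le (p p' : nat) : (p <= n)%N ->
  (2 * p' - n + (n - 2 * p') <= 2 * p - n + (n - 2 * p))%N ->
  sin (p%:R * x) <= sin (p'%:R * x).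
Proof. by move=> pn h; rewrite !sin_cos; apply: cos_le; lia. Qed.

Let sin_ge0 (p : nat) : (p <= n)%N -> 0 <= sin (p%:R * x).
Proof.
move=> pn; rewrite sin_ge0_pi// mulr_ge0 ?(ltW x0)//= -nx ler_pM2r//.
by rewrite ler_nat.
Qed.

Let m := (n %/ 4)%N.
Let S := sin ((2 * m + 1)%N%:R * x).

(** [2 m + 1] is an odd number nearest to [n / 2], so its multiple of [x] is nearest to the right
    angle; the reflection of [p] to [2 n - p] handles [p > n]. *)
Let odd_sin (p : nat) : odd p -> (p < 2 * n)%N -> `|sin (p%:R * x)| <= S.
Proof.
move=> op pn; wlog : p op pn / (p <= n)%N.
  move=> H; have [/H|np] := leqP p n; first exact.
  have -> : sin (p%:R * x) = - sin ((2 * n - p)%N%:R * x).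
    have -> : (2 * n - p)%N%:R * x = - (p%:R * x) + pi *+ 2.
      by rewrite (natrB _ (ltnW pn)) natrM mulrBl -mulrA nx -[pi *+ 2]mulr_natl addrC.
    by rewrite sinD2pi sinN opprK.
  by rewrite normrN; apply: H; lia.
move=> pn'; rewrite ger0_norm ?sin_ge0//; apply: sin_le => //.
by rewrite /m; lia.
Qed.

(** The Dirichlet kernel identity. At [k = m] it gives [S], so
    [flake_radius n = sin x / (S + sin x)]. *)
Let dirichlet (k : nat) :
  sin x * (1 + 2 * \sum_(1 <= i < k.+1) cos (2 * pi * i%:R / n%:R)) =
  sin ((2 * k + 1)%N%:R * x).
Proof.
elim: k => [|k IHk]; first by rewrite big_geq// mulr0 addr0 mulr1 muln0 add0n mul1r.
rewrite big_nat_recr//=; move: IHk; set T := \sum_(_ <= _ < _) _ => IHk.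
set w := cos _.
have -> : sin x * (1 + 2 * (T + w)) = sin x * (1 + 2 * T) + 2 * sin x * w by ring.
rewrite IHk /w.
have -> : 2 * pi * k.+1%:R / n%:R = (2 * k + 2)%N%:R * x.
  by rewrite /x natrD natrM -[k.+1%:R]natr1; ring.
have -> : (2 * k + 1)%N%:R * x = (2 * k + 2)%N%:R * x - x by rewrite !natrD; ring.
have -> : (2 * k.+1 + 1)%N%:R * x = (2 * k + 2)%N%:R * x + x.
  by rewrite !natrD !natrM -[k.+1%:R]natr1; ring.
by rewrite sinB sinD; ring.
Qed.

Let cos_sum_ge0 : 0 <= \sum_(1 <= k < m.+1) cos (2 * pi * k%:R / n%:R) :> R.
Proof.
rewrite big_nat_cond; apply: sumr_ge0 => k /andP[/andP[k1 km] _].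
have -> : 2 * pi * k%:R / n%:R = (4 * k)%N%:R * (x / 2).
  by rewrite /x natrM; field; rewrite gt_eqF.
apply: cos_ge0_pihalf; rewrite -nx; apply/andP; split.
  apply: (@le_trans _ _ 0); last by rewrite mulr_ge0// divr_ge0// (ltW x0).
  by rewrite oppr_le0 divr_ge0// mulr_ge0// (ltW x0).
have x20 : 0 < x / 2 by exact: divr_gt0.
rewrite -[leRHS]mulrA ler_pM2r// ler_nat.
by move: km; rewrite /m; lia.
Qed.

Lemma flake_radius_lt1 (r : R) : 0 < r -> r < flake_radius n -> r < 1.
Proof.
move=> r0 rR; apply: lt_trans rR _; rewrite /flake_radius -invfM
  invf_lt1; have := cos_sum_ge0; rewrite /m; lra.
Qed.

Let radius_sin (r : R) : 0 < r -> r < flake_radius n -> r * S < (1 - r) * sin x.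
Proof.
move=> r0; rewrite /flake_radius -invfM /S -dirichlet.
have := cos_sum_ge0; rewrite -/m; set s := \sum_(_ <= _ < _) _ => s0.
have sx : 0 < sin x.
  apply: sin_gt0_pi; rewrite x0 -nx ltr_pMl// ltr1n; lia.
have p0 : 0 < 2 * (1 + s) by lra.
rewrite -div1r ltr_pdivlMr// => h.
by rewrite mulrCA [ltRHS]mulrC ltr_pM2l//; lra.
Qed.

(** Up to the circumradius, [B] bounds the projections of the vertices, taken from the centre, to
    the direction joining vertices [i] and [j]. The first inequality says that the gap between the
    two fixed points exceeds the spread of the contracted copies. *)
Lemma separating_bound (r : R) (i j : nat) : 0 < r -> r < flake_radius n ->
  (1 <= i <= n)%N -> (1 <= j <= n)%N -> i != j ->
  exists B, r * B < (1 - r) * `|sin ((i%:R - j%:R) * x)| /\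
    forall k, (1 <= k <= n)%N -> `|sin ((2 * k%:R - i%:R - j%:R) * x)| <= B.
Proof.
move=> r0 rR; wlog ij : i j / (i < j)%N.
  move=> H iN jN ij; have [lij|lji|eij] := ltngtP i j; first exact: H.
    have [|B [hB1 hB2]] := H j i lji jN iN; first by rewrite eq_sym.
    exists B; split; first by rewrite -normrN -sinN -mulNr opprB.
    by move=> k kN; rewrite addrAC; exact: hB2.
  by move: ij; rewrite eij eqxx.
move=> iN jN _; have r1 := flake_radius_lt1 r0 rR.
have rS := radius_sin r0 rR.
have -> : `|sin ((i%:R - j%:R) * x)| = sin ((j - i)%N%:R * x).
  rewrite -normrN -sinN -mulNr opprB -(natrB _ (ltnW ij)) ger0_norm//.
  by apply: sin_ge0; lia.
have [dmid|dend] := boolP ((2 <= j - i) && (j - i <= n - 2))%N.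
  (* For nonadjacent vertices the trivial bound suffices. Multiplying [radius_sin] by [2 cos x] and
     using [cos x <= S] gives [2 r cos x ^+ 2 < (1 - r) sin (2 x)], while [2 cos x ^+ 2 >= 1] since
     here [n >= 4]. *)
  exists 1; split; last by move=> k _; exact: sin_max.
  have s2 : sin (2%:R * x) <= sin ((j - i)%N%:R * x) by apply: sin_le; lia.
  have cS : cos x <= S.
    rewrite /S sin_cos; have -> : cos x = cos (2%:R * (x / 2)) by congr cos; field.
    by apply: cos_le; rewrite /m; lia.
  have c2 : 0 <= cos (2%:R * x).
    apply: cos_ge0_pihalf; apply/andP; split; first by have := pi_gt0 R; have := x0; lra.
    have n4 : 4%:R <= n%:R :> R by rewrite ler_nat; lia.
    by rewrite -nx; have := ler_wpM2r (ltW x0) n4; lra.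
  have sD : sin (2%:R * x) = 2 * cos x * sin x by rewrite mulr_natl sin_mulr2n; ring.
  have cD : cos (2%:R * x) = 2 * cos x ^+ 2 - 1 by rewrite mulr_natl cos_mulr2n; ring.
  have cx : 0 < cos x.
    apply: cos_gt0_pihalf; apply/andP; split; first by have := pi_gt0 R; have := x0; lra.
    have n3R : 3%:R <= n%:R :> R by rewrite ler_nat.
    by rewrite -nx; have := ler_wpM2r (ltW x0) n3R; have := x0; lra.
  rewrite mulr1; apply: (@lt_le_trans _ _ ((1 - r) * sin (2%:R * x))); last first.
    by rewrite ler_pM2l// subr_gt0.
  rewrite sD.
  have h1 : r * S * (2 * cos x) < (1 - r) * sin x * (2 * cos x) by rewrite ltr_pM2r//; lra.
  have h2 : r * cos x * (2 * cos x) <= r * S * (2 * cos x).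
    by rewrite ler_pM2r ?ler_pM2l//; lra.
  rewrite cD in c2; have := mulr_ge0 (ltW r0) c2; lra.
(* What remains are the adjacent vertices, including the pair closing the polygon. *)
have d1 : (j - i = 1 \/ (i = 1 /\ j = n))%N by lia.
exists S; split.
  apply: lt_le_trans rS _; rewrite ler_pM2l ?subr_gt0// -{1}(mul1r x).
  by apply: (@sin_le 1); lia.
move=> k kN; case: d1 => [d1|[i1 jn]].
  have [kj|ki] := leqP j k.
    have -> : (2 * k%:R - i%:R - j%:R) = (2 * k - i - j)%N%:R :> R.
      by rewrite !natrB ?natrM//; lia.
    by apply: odd_sin; lia.
  rewrite -normrN -sinN -mulNr.
  have -> : - (2 * k%:R - i%:R - j%:R) = (i + j - 2 * k)%N%:R :> R.
    by rewrite natrB ?natrM ?natrD; [ring|lia].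
  by apply: odd_sin; lia.
(* For the closing pair, [n x = pi] turns the angle into an odd multiple of [x] up to a half
   turn. *)
have -> : (2 * k%:R - i%:R - j%:R) * x = (2 * k - 1)%N%:R * x - pi.
  by rewrite i1 jn natrB ?natrM -?nx; [ring|lia].
rewrite -normrN -(sinDpi) subrK.
by apply: odd_sin; lia.
Qed.

End Angles.

(** * Separation of the pieces of the flake dust *)

Section Flake.
Context {R : realType}.
Implicit Types (A B F : set (R * R)) (V : nat -> R * R).

Lemma closest_pair A B : compact A -> compact B -> A !=set0 -> B !=set0 ->
  exists pq : (R * R) * (R * R), [/\ A pq.1, B pq.2 &
    forall p q, A p -> B q -> enorm (pq.1 - pq.2) <= enorm (p - q)].
Proof.
move=> cA cB [p0 Ap0] [q0 Bq0].
have cont : continuous (fun pq : (R * R) * (R * R) => enorm (pq.1 - pq.2)).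
  move=> pq; apply: (@continuous_comp _ _ _ (fun pq : (R * R) * (R * R) => pq.1 - pq.2)).
    by apply: cvgB; [exact: cvg_fst|exact: cvg_snd].
  exact: continuous_enorm.
have [|||pq /set_mem[Ap Bq] pqP] := @compact_EVT_min _ R
  (fun pq : (R * R) * (R * R) => enorm (pq.1 - pq.2)) (A `*` B).
- by exists (p0, q0).
- exact: compact_setX.
- exact: continuous_subspaceT.
by exists pq; split => // p q Ap' Bq'; apply: (pqP (p, q)); rewrite inE.
Qed.

(** At a maximum point [y] on [F], lying in some piece, [f y <= r f y + (1 - r) b], hence
    [f y <= b]; no convex hull is involved. *)
Lemma flake_bound n V r F c (u w b : R) : 0 < r < 1 -> is_flake_dust n V r F ->
  (forall k, (1 <= k <= n)%N -> `|u * (V k - c).1 + w * (V k - c).2| <= b) ->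
  forall z, F z -> `|u * (z - c).1 + w * (z - c).2| <= b.
Proof.
move=> /andP[r0 r1] [F0 cF FE] Vb.
pose f (z : R * R) := `|u * (z - c).1 + w * (z - c).2|.
have cf : continuous f.
  have c1 (z : R * R) : (t - c).1 @[t --> z] --> (z - c).1.
    by apply: (@cvgB _ _ _ _ _ fst (fun=> c.1)); [exact: cvg_fst|exact: cvg_cst].
  have c2 (z : R * R) : (t - c).2 @[t --> z] --> (z - c).2.
    by apply: (@cvgB _ _ _ _ _ snd (fun=> c.2)); [exact: cvg_snd|exact: cvg_cst].
  by move=> z; apply: cvg_norm; apply: cvgD; apply: cvgMr; [exact: c1|exact: c2].
have [|y /set_mem Fy yP] := compact_EVT_max F0 cF (_ : {within F, continuous f}).
  exact: continuous_subspaceT.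
have fy : f y <= b.
  move: (Fy); rewrite {1}FE => -[k kn [x Fx xy]].
  have fx := yP x (mem_set Fx).
  have r1' : 0 < 1 - r by rewrite subr_gt0.
  have : f y <= r * f x + (1 - r) * b.
    rewrite {1}/f -xy /flake_sim.
    have -> : u * (r *: x + (1 - r) *: V k - c).1 +
        w * (r *: x + (1 - r) *: V k - c).2
      = r * (u * (x - c).1 + w * (x - c).2) +
        (1 - r) * (u * (V k - c).1 + w * (V k - c).2).
      by rewrite /= /GRing.scale/=; ring.
    apply: le_trans (ler_normD _ _) _; rewrite !normrM (gtr0_norm r0) (gtr0_norm r1').
    by apply: lerD => //; rewrite ler_pM2l// Vb.
  have : r * f x <= r * f y by rewrite ler_pM2l.
  move=> h1 h2; rewrite -(ler_pM2l r1'); lra.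
by move=> z Fz; apply: le_trans (yP z (mem_set Fz)) fy.
Qed.

(* The functional [phi] is the projection to the direction of [V i - V j]; on [F]
   it spreads at most [2 rho B] by [flake_bound], too little to bridge
   [(1 - r) |phi (V i - V j)|]. *)
Lemma flake_pieces_disjoint n V r F i j x y :
  (3 <= n)%N -> 0 < r -> r < flake_radius n -> regular_ngon n V -> is_flake_dust n V r F ->
  (1 <= i <= n)%N -> (1 <= j <= n)%N -> i != j -> F x -> F y ->
  flake_sim V r i x <> flake_sim V r j y.
Proof.
move=> n3 r0 rR [c [rho [theta [s [rho0 VE]]]]] hF iN jN ij Fx Fy.
have r1 := flake_radius_lt1 n3 r0 rR.
have [B [hB sB]] := separating_bound n3 r0 rR iN jN ij.
pose sg : R := (-1) ^+ s.
have sgn z : `|sin (sg * z)| = `|sin z|.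
  by rewrite /sg; case: (s); rewrite ?expr1 ?expr0 ?mulN1r ?mul1r// sinN normrN.
pose al k : R := theta + sg * (2 * pi * k%:R / n%:R).
(* [M] is the mean of the two vertex angles, so [phi] projects along the chord and takes opposite
   values at [V i - c] and [V j - c]. The orientation [sg] disappears in absolute values. *)
pose M := (al i + al j) / 2.
pose phi (z : R * R) := - sin M * z.1 + cos M * z.2.
have phiV k : (1 <= k <= n)%N -> phi (V k - c) = rho * sin (al k - M).
  move=> kN; have -> := VE _ kN; rewrite -/(al k) /phi sinB /= /GRing.scale/=; ring.
have alM k : al k - M = sg * ((2 * k%:R - i%:R - j%:R) * (pi / n%:R)).
  by rewrite /M /al; field; rewrite pnatr_eq0; lia.
have bd z : F z -> `|phi (z - c)| <= rho * B.
  apply: (flake_bound (V := V) (r := r) (n := n)) => //; first by rewrite r0.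
  move=> k kN; rewrite -/(phi _) phiV// alM normrM gtr0_norm// ler_pM2l// sgn.
  exact: sB.
move=> E.
have : phi (flake_sim V r i x) = phi (flake_sim V r j y) by rewrite E.
have phiS k z : phi (flake_sim V r k z) =
    r * phi (z - c) + (1 - r) * phi (V k - c) + phi c.
  by rewrite /phi /flake_sim /= /GRing.scale/=; ring.
rewrite !phiS !phiV// => E2.
have siM : sin (al i - M) = sin (sg * ((i%:R - j%:R) * (pi / n%:R))).
  by rewrite alM; congr (sin (_ * (_ * _))); ring.
have sjM : sin (al j - M) = - sin (sg * ((i%:R - j%:R) * (pi / n%:R))).
  by rewrite alM -sinN -mulrN -mulNr; congr (sin (_ * (_ * _))); ring.
rewrite siM sjM in E2; set t := sin (sg * _) in E2.
have ht : r * B < (1 - r) * `|t| by rewrite /t sgn.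
have E3 : (1 - r) * (rho * t) * 2 = r * (phi (y - c) - phi (x - c)) by lra.
have E4 : (1 - r) * rho * `|t| * 2 <= r * (2 * (rho * B)).
  have -> : (1 - r) * rho * `|t| * 2 = `|(1 - r) * (rho * t) * 2|.
    rewrite !normrM (gtr0_norm rho0) (gtr0_norm (_ : 0 < 1 - r)) ?subr_gt0//.
    by rewrite normr_nat; ring.
  rewrite E3 normrM gtr0_norm// ler_pM2l//.
  by have := ler_normB (phi (y - c)) (phi (x - c)); have := bd _ Fx; have := bd _ Fy; lra.
have : r * B * (2 * rho) < (1 - r) * `|t| * (2 * rho) by rewrite ltr_pM2r// mulr_gt0.
lra.
Qed.

Lemma flake_dust_not_minkowski_measurable n V r F : (3 <= n)%N -> 0 < r ->
  r < flake_radius n -> regular_ngon n V -> is_flake_dust n V r F ->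
  ~ minkowski_measurable F.
Proof.
move=> n3 r0 rR hV hF; have r1 := flake_radius_lt1 n3 r0 rR.
have [F0 cF FE] := hF.
(* Pieces are numbered from [0], vertices from [1]. *)
pose v k := (1 - r) *: V k.+1; pose piece k := homothety r (v k) @` F.
have pieceE k : piece k = flake_sim V r k.+1 @` F by [].
have cpiece k : compact (piece k) by exact: compact_homothety.
have piece0 k : piece k !=set0 by have [z Fz] := F0; exists (homothety r (v k) z); exists z.
have FE' : F = \bigcup_(k < n) piece k.
  rewrite {1}FE; apply/seteqP; split => z.
    by move=> [[//|k] kn Pz]; exists k.
  by move=> [k kn Pz]; exists k.+1.
have [f fP] := choice (fun ij : 'I_n * 'I_n =>
  closest_pair (cpiece ij.1) (cpiece ij.2) (piece0 ij.1) (piece0 ij.2)).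
have n0 : (0 < n)%N by lia.
have n1 : (1 < n)%N by lia.
pose P : pred ('I_n * 'I_n) := fun ij => ij.1 != ij.2.
have ok : P (Ordinal n0, Ordinal n1) by [].
have [[i0 j0] /= ij0 min0] :=
  arg_minP (fun ij : 'I_n * 'I_n => enorm ((f ij).1 - (f ij).2)) (ok : P _).
have [/= Pp0 Pq0 _] := fP (i0, j0).
set p0 := (f (i0, j0)).1 in Pp0 min0; set q0 := (f (i0, j0)).2 in Pq0 min0.
(* A zero distance would give a common point of two different pieces. *)
have pq0 : 0 < enorm (p0 - q0).
  rewrite lt_neqAle enorm_ge0 andbT eq_sym; apply/eqP => /enorm_eq0/eqP.
  rewrite subr_eq0 => /eqP pq.
  have [x Fx xp] := Pp0; have [y Fy yq] := Pq0.
  apply: (@flake_pieces_disjoint n V r F i0.+1 j0.+1 x y) => //; first exact: ltn_ord.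
    exact: ltn_ord.
  by rewrite -[LHS]/(homothety r (v i0) x) -[RHS]/(homothety r (v j0) y) xp yq.
apply: (@strong_separation_not_minkowski_measurable _ F n r (enorm (p0 - q0) / 2) v
  r0 r1 _ cF F0 FE' _ i0 j0 p0 q0) => //.
- by rewrite divr_gt0.
- move=> i j p q iN jN ij Pp Pq.
  have -> : 2 * (enorm (p0 - q0) / 2) = enorm (p0 - q0) by field.
  apply: le_trans (min0 (Ordinal iN, Ordinal jN) ij) _.
  by have [_ _] := fP (Ordinal iN, Ordinal jN); apply.
- by field.
Qed.

End Flake.

Theorem theorem4p6 (R : realType) (n : nat) (r : R) (V : nat -> R * R)
    (F : set (R * R)) (hn : (3 <= n)%N) (hr0 : 0 < r) (hr1 : r < flake_radius n)
    (hV : regular_ngon n V) (hF : is_flake_dust n V r F) :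
  let l := dist (flake_sim V r 1 @` F) (flake_sim V r 2 @` F) in
  let g := hole_threshold F in
  r < l / (2 * g) -> ~ minkowski_measurable F.
Proof.
move=> l g _; exact: flake_dust_not_minkowski_measurable hn hr0 hr1 hV hF.
Qed.
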